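(* Let $\mathbf{E}: 1\to H\xrightarrow{i} G\xrightarrow{\pi} Q\to 1$ be an extension of groups with associated homomorphism $\Phi:Q\to\operatorname{Out}(H)$, so $\mathbf{E}\in\mathcal X_\Phi(Q,H)$. There is an exact sequence $$0\to Z^1(Q,zH)\xrightarrow{\ \mu\ }\operatorname{Aut}(G,H)\xrightarrow{\ \mathrm{res}\ }\mathcal S\xrightarrow{\ \lambda_{\mathbf{E}}\ }H^2(Q,zH),$$ where $Q$ acts on $zH$ via $\Phi$ and $Z^1(Q,zH)$ is the group of $1$-cocycles for this action. Here $\mu(\sigma)=\varphi_\sigma$ with $\varphi_\sigma(g)=\sigma(\pi g)\,g$ (product in $G$), the maps $\mu$ and $\mathrm{res}$ are group homomorphisms, and $\lambda_{\mathbf{E}}$ is a derivation, i.e. $\lambda_{\mathbf{E}}(\theta\theta')=\lambda_{\mathbf{E}}(\theta)\theta'+\lambda_{\mathbf{E}}(\theta')$ for all $\theta,\theta'\in\mathcal S$. Exactness at $\mathcal S$ means $\operatorname{image}(\mathrm{res})=\{\theta\in\mathcal S : \lambda_{\mathbf{E}}(\theta)=0\}$.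
   Context: $H$ is identified with the normal subgroup $i(H)$ of $G$; $zH$ is the centre of $H$; $c_g$ is conjugation $x\mapsto gxg^{-1}$; $[\varphi]\in\operatorname{Out}(H)$ is the class of $\varphi\in\operatorname{Aut}(H)$. The homomorphism $\Phi:Q\to\operatorname{Out}(H)$ associated to $\mathbf{E}$ is $\Phi(q)=[c_g|_H]$ for any $g\in G$ with $\pi(g)=q$; it gives a well-defined action of $Q$ on $zH$, and $H^*(Q,zH)$ is taken with respect to it. $c_{[\alpha]}$ is conjugation by $[\alpha]$ in $\operatorname{Out}(H)$. $\operatorname{Aut}(G,H)$ is the group of automorphisms of $G$ that restrict to an automorphism of $H$. $\mathcal S=\{(\alpha,\beta)\in\operatorname{Aut}(H)\times\operatorname{Aut}(Q) : \Phi\beta=c_{[\alpha]}\Phi\}$, a subgroup. $\mathrm{res}(\gamma)=(\gamma|_H,\gamma')$ where $\gamma'\in\operatorname{Aut}(Q)$ is determined by $\gamma'\pi=\pi\gamma$. $\mathcal X_\Phi(Q,H)$ is the set of equivalence classes of extensions of $Q$ by $H$ with associated homomorphism $\Phi$ (equivalence: an isomorphism of middle groups inducing the identity on $H$ and on $Q$). Write $H$ and $G$ additively and $Q$ multiplicatively. Every extension is equivalent to some $\mathbf{E}_{f,\varphi}: 1\to H\to E_{f,\varphi}\to Q\to 1$, where (for a normalized section $u$ with $u(1)=0$) $\varphi(q)=c_{u(q)}|_H\in\operatorname{Aut}(H)$, $f(q,q')=u(q)+u(q')-u(qq')\in H$, and $E_{f,\varphi}=H\times Q$ with $(n,q)+(n',q')=(n+\varphi(q)n'+f(q,q'),qq')$.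 For $\alpha\in\operatorname{Aut}(H)$, $\alpha_*\mathbf{E}_{f,\varphi}:=\mathbf{E}_{\alpha f,\ \alpha\varphi(\cdot)\alpha^{-1}}$, well defined on equivalence classes; for a homomorphism $\beta:Q'\to Q$, $\beta^*\mathbf{E}$ is the pullback extension. For $\theta=(\alpha,\beta)\in\mathcal S$ set $\mathbf{E}\theta=(\alpha^{-1})_*\beta^*\mathbf{E}$; this is a right action of $\mathcal S$ on $\mathcal X_\Phi(Q,H)$. $\mathcal S$ acts on the right on $H^2(Q,zH)$ by $[c]\theta=[\alpha^{-1}\circ c\circ(\beta\times\beta)]$. $H^2(Q,zH)$ acts simply transitively on $\mathcal X_\Phi(Q,H)$ by $\mathbf{E}_{f,\varphi}\cdot[c]=\mathbf{E}_{f+c,\varphi}$. For $\mathbf{E},\mathbf{E}'\in\mathcal X_\Phi(Q,H)$ with $\mathbf{E}=\mathbf{E}_0\zeta$, $\mathbf{E}'=\mathbf{E}_0\zeta'$ for any basepoint $\mathbf{E}_0$, put $(\mathbf{E}-\mathbf{E}')=\zeta-\zeta'\in H^2(Q,zH)$ (independent of $\mathbf{E}_0$). Finally $\lambda_{\mathbf{E}}(\theta)=(\mathbf{E}-\mathbf{E}\theta)$. *)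

(* Defs.v *)
From HB Require Import structures.
From mathcomp Require Import all_boot ssralg ring_quotient.
From mathcomp Require Import boolp classical_sets functions.

Set Implicit Arguments.
Unset Strict Implicit.
Unset Printing Implicit Defensive.

Import GRing.Theory.
Local Open Scope quotient_scope.
Local Open Scope classical_set_scope.
Local Open Scope group_scope.

(* [groupType] only provides [{multiplicative G -> K}]; between groups such a
   map automatically preserves 1 and inverses. *)
Lemma hom1 (G K : groupType) (f : {multiplicative G -> K}) : f 1 = 1.
Proof. by apply: (mulIg (f 1)); rewrite -gmulfM !mul1g. Qed.

Lemma homV (G K : groupType) (f : {multiplicative G -> K}) x :
  f x^-1 = (f x)^-1.
Proof. by apply: (mulIg (f x)); rewrite -gmulfM !mulVg hom1. Qed.

Record Aut (G : groupType) := MkAut {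
  aut_fun :> G -> G;
  aut_inv : G -> G;
  aut_funM : {morph aut_fun : x y / x * y};
  aut_funK : cancel aut_fun aut_inv;
  aut_invK : cancel aut_inv aut_fun }.

HB.instance Definition _ (G : groupType) := gen_eqMixin (Aut G).
HB.instance Definition _ (G : groupType) := gen_choiceMixin (Aut G).
HB.instance Definition _ (G : groupType) (a : Aut G) :=
  isMultiplicative.Build G G (aut_fun a) (@aut_funM G a).

Section AutGroup.
Variable G : groupType.
Implicit Types a b : Aut G.

Lemma autP a b : (forall x, a x = b x) -> a = b.
Proof.
case: a b => [f g fM fK gK] [f' g' fM' fK' gK'] /= /funext E.
move: fM' fK' gK'; rewrite -{}E => fM' fK' gK'.
have E : g' = g by apply/funext => x; rewrite -[in LHS](gK x) fK'.
by move: fK' gK'; rewrite E => fK' gK'; congr MkAut; exact: Prop_irrelevance.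
Qed.

Definition aut_one : Aut G :=
  @MkAut G id id (fun _ _ => erefl) (fun _ => erefl) (fun _ => erefl).

Lemma aut_invM a : {morph aut_inv a : x y / x * y}.
Proof.
by move=> x y; apply: (can_inj (@aut_funK G a)); rewrite aut_funM !aut_invK.
Qed.

Definition aut_V a : Aut G :=
  MkAut (@aut_invM a) (@aut_invK G a) (@aut_funK G a).

Lemma aut_compM a b : {morph a \o b : x y / x * y}.
Proof. by move=> x y /=; rewrite !aut_funM. Qed.

(* The product of [Aut G] is ordinary composition: [(a * b) x = a (b x)]. *)
Definition aut_mul a b : Aut G :=
  MkAut (@aut_compM a b) (can_comp (@aut_funK G a) (@aut_funK G b))
    (can_comp (@aut_invK G b) (@aut_invK G a)).

Lemma aut_mulA : associative aut_mul. Proof. by move=> a b c; apply: autP. Qed.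
Lemma aut_mul1 : left_id aut_one aut_mul. Proof. by move=> a; apply: autP. Qed.
Lemma aut_mulr1 : right_id aut_one aut_mul. Proof. by move=> a; apply: autP. Qed.
Lemma aut_mulV : left_inverse aut_one aut_V aut_mul.
Proof. by move=> a; apply: autP => x /=; rewrite aut_funK. Qed.
Lemma aut_mulrV : right_inverse aut_one aut_V aut_mul.
Proof. by move=> a; apply: autP => x /=; rewrite aut_invK. Qed.

HB.instance Definition _ :=
  isGroup.Build (Aut G) aut_mulA aut_mul1 aut_mulr1 aut_mulV aut_mulrV.

Lemma autM a b x : (a * b) x = a (b x). Proof. by []. Qed.
Lemma aut1 x : (1 : Aut G) x = x. Proof. by []. Qed.
Lemma autVK a x : a^-1 (a x) = x. Proof. exact: aut_funK. Qed.
Lemma autKV a x : a (a^-1 x) = x. Proof. exact: aut_invK. Qed.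

Definition inner_fun (h x : G) := h * x * h^-1.

Lemma inner_funM h : {morph inner_fun h : x y / x * y}.
Proof. by move=> x y; rewrite /inner_fun !mulgA mulgVK. Qed.
Lemma inner_funK h : cancel (inner_fun h) (inner_fun h^-1).
Proof. by move=> x; rewrite /inner_fun invgK !mulgA mulVg mul1g mulgVK. Qed.
Lemma inner_funVK h : cancel (inner_fun h^-1) (inner_fun h).
Proof. by move=> x; rewrite -{1}[h]invgK inner_funK. Qed.

Definition inner h : Aut G :=
  MkAut (@inner_funM h) (@inner_funK h) (@inner_funVK h).

Lemma innerM h k : inner (h * k) = inner h * inner k.
Proof. by apply: autP => x; rewrite autM /= /inner_fun invgM !mulgA. Qed.
Lemma inner1 : inner 1 = 1.
Proof. by apply: autP => x; rewrite /= /inner_fun mul1g invg1 mulg1. Qed.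
Lemma innerV h : inner h^-1 = (inner h)^-1.
Proof. by apply: autP. Qed.
Lemma innerJ a h : a * inner h = inner (a h) * a.
Proof.
by apply: autP => x; rewrite !autM /= /inner_fun !aut_funM [a h^-1]homV.
Qed.

Definition out_rel a b : bool := `[< exists h, a = inner h * b >].

Lemma out_rel_refl : reflexive out_rel.
Proof. by move=> a; apply/asboolP; exists 1; rewrite inner1 mul1g. Qed.
Lemma out_rel_sym : symmetric out_rel.
Proof.
have H a b : out_rel a b -> out_rel b a.
  move=> /asboolP[h ->]; apply/asboolP; exists h^-1.
  by rewrite innerV mulgA mulVg mul1g.
by move=> a b; apply/idP/idP; apply: H.
Qed.
Lemma out_rel_trans : transitive out_rel.
Proof.
move=> b a c /asboolP[h ->] /asboolP[k ->]; apply/asboolP.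
by exists (h * k); rewrite innerM mulgA.
Qed.

Canonical out_equiv := EquivRel out_rel out_rel_refl out_rel_sym out_rel_trans.

Definition Out := {eq_quot out_equiv}.
HB.instance Definition _ := EqQuotient.on Out.
HB.instance Definition _ := Choice.on Out.

Lemma outP a b : reflect (exists h, a = inner h * b) (a == b %[mod Out]).
Proof. by rewrite eqmodE; apply: asboolP. Qed.

Definition out_one : Out := lift_cst Out 1.
Definition out_mul := lift_op2 Out (fun a b : Aut G => a * b).
Definition out_inv := lift_op1 Out (fun a : Aut G => a^-1).

Lemma pi_out_mul : {morph \pi_Out : a b / (a * b : Aut G) >-> out_mul a b}.
Proof.
move=> a b; unlock out_mul; apply/eqP/outP.
have /eqP/outP[h ha] : a = repr (\pi_Out a) %[mod Out] by rewrite reprK.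
have /eqP/outP[k hb] : b = repr (\pi_Out b) %[mod Out] by rewrite reprK.
set a' := repr (\pi_Out a) in ha *; set b' := repr (\pi_Out b) in hb *.
exists (h * a' k); rewrite {}ha {}hb innerM -!mulgA; congr (_ * _).
by rewrite !mulgA innerJ.
Qed.

Lemma pi_out_inv : {morph \pi_Out : a / (a^-1 : Aut G) >-> out_inv a}.
Proof.
move=> a; unlock out_inv; apply/eqP/outP.
have /eqP/outP[h ha] : a = repr (\pi_Out a) %[mod Out] by rewrite reprK.
set a' := repr (\pi_Out a) in ha *.
by exists (a'^-1 h^-1); rewrite {}ha -innerJ invgM innerV.
Qed.

Lemma pi_out_1 : \pi_Out 1 = out_one. Proof. by unlock out_one. Qed.

Lemma out_mulA : associative out_mul.
Proof.
by move=> x y z; rewrite -[x]reprK -[y]reprK -[z]reprK -!pi_out_mul mulgA.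
Qed.
Lemma out_mul1 : left_id out_one out_mul.
Proof. by move=> x; rewrite -[x]reprK -pi_out_1 -pi_out_mul mul1g. Qed.
Lemma out_mulr1 : right_id out_one out_mul.
Proof. by move=> x; rewrite -[x]reprK -pi_out_1 -pi_out_mul mulg1. Qed.
Lemma out_mulV : left_inverse out_one out_inv out_mul.
Proof. by move=> x; rewrite -[x]reprK -pi_out_inv -pi_out_mul mulVg pi_out_1. Qed.
Lemma out_mulrV : right_inverse out_one out_inv out_mul.
Proof. by move=> x; rewrite -[x]reprK -pi_out_inv -pi_out_mul mulgV pi_out_1. Qed.

HB.instance Definition _ :=
  isGroup.Build Out out_mulA out_mul1 out_mulr1 out_mulV out_mulrV.

Lemma pi_outM a b : \pi_Out (a * b) = \pi_Out a * \pi_Out b.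
Proof. exact: pi_out_mul. Qed.
Lemma pi_outV a : \pi_Out a^-1 = (\pi_Out a)^-1.
Proof. exact: pi_out_inv. Qed.

End AutGroup.

Section Centre.
Variable H : groupType.

Definition central : {pred H} := fun z => `[< forall x : H, z * x = x * z >].

Record cen := MkCen { cval : H; cvalP : cval \in central }.
HB.instance Definition _ := [isSub for cval].
HB.instance Definition _ := [Choice of cen by <:].

Implicit Types z t : cen.

Lemma cenP z (x : H) : cval z * x = x * cval z.
Proof. by have /asboolP := cvalP z. Qed.
Lemma cenI (x : H) : (forall y, x * y = y * x) -> x \in central.
Proof. by move=> h; apply/asboolP. Qed.

Lemma cen0_subproof : (1 : H) \in central.
Proof. by apply: cenI => x; rewrite mul1g mulg1. Qed.
Lemma cenD_subproof z t : cval z * cval t \in central.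
Proof. by apply: cenI => x; rewrite -mulgA (cenP t) !mulgA (cenP z x). Qed.
Lemma cenN_subproof z : (cval z)^-1 \in central.
Proof.
by apply: cenI => x; apply: (mulgI (cval z)); rewrite mulgA mulgV mul1g mulgA (cenP z x) mulgK.
Qed.

Definition cen0 := MkCen cen0_subproof.
Definition cenD z t := MkCen (cenD_subproof z t).
Definition cenN z := MkCen (cenN_subproof z).

Lemma cenDA : associative cenD.
Proof. by move=> x y z; apply: val_inj; rewrite /= mulgA. Qed.
Lemma cenDC : commutative cenD.
Proof. by move=> x y; apply: val_inj; rewrite /= cenP. Qed.
Lemma cen0D : left_id cen0 cenD.
Proof. by move=> x; apply: val_inj; rewrite /= mul1g. Qed.
Lemma cenND : left_inverse cen0 cenN cenD.
Proof. by move=> x; apply: val_inj; rewrite /= mulVg. Qed.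

(* The centre is written additively: [cval (z + t) = cval z * cval t]. *)
HB.instance Definition _ := GRing.isZmodule.Build cen cenDA cenDC cen0D cenND.

Lemma cvalD z t : cval (z + t)%R = cval z * cval t. Proof. by []. Qed.
Lemma cval0 : cval 0%R = 1. Proof. by []. Qed.
Lemma cvalN z : cval (- z)%R = (cval z)^-1. Proof. by []. Qed.

Lemma cen_aut_subproof (a : Aut H) z : a (cval z) \in central.
Proof.
by apply: cenI => x; rewrite -[x](autKV a) -!aut_funM cenP.
Qed.
Definition cen_aut (a : Aut H) z : cen := MkCen (cen_aut_subproof a z).

Lemma cen_aut_is_additive a : zmod_morphism (cen_aut a).
Proof.
move=> x y; apply: val_inj.
by rewrite /= aut_funM [a (_^-1)](@homV _ _ (aut_fun a)).
Qed.
HB.instance Definition _ a :=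
  GRing.isZmodMorphism.Build cen cen (cen_aut a) (cen_aut_is_additive a).

Lemma cen_autM a b z : cen_aut (a * b) z = cen_aut a (cen_aut b z).
Proof. exact: val_inj. Qed.

(* Inner automorphisms are trivial on the centre, so the choice of a
   representative of the outer class is immaterial; see [cen_outE]. *)
Definition cen_out (o : Out H) z : cen := cen_aut (repr o) z.
HB.instance Definition _ o :=
  GRing.isZmodMorphism.Build cen cen (cen_out o) (cen_aut_is_additive (repr o)).

Lemma cen_outE a z : cen_out (\pi_(Out H) a) z = cen_aut a z.
Proof.
have /eqP/outP[h ha] : repr (\pi_(Out H) a) = a %[mod Out H] by rewrite reprK.
apply: val_inj; rewrite /= ha autM /= /inner_fun.
by have /= <- := cenP (cen_aut a z) h; rewrite mulgK.
Qed.

Lemma cen_outM o p z : cen_out (o * p) z = cen_out o (cen_out p z).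
Proof.
by rewrite -[o]reprK -[p]reprK -pi_outM !cen_outE cen_autM.
Qed.

End Centre.

Section Cohomology.
Variables (H Q : groupType) (Phi : Q -> Out H).

Definition qact (q : Q) : cen H -> cen H := cen_out (Phi q).
HB.instance Definition _ q := GRing.isZmodMorphism.Build (cen H) (cen H) (qact q)
  (cen_aut_is_additive (repr (Phi q))).

Definition cocycle1 : {pred Q -> cen H} := fun s =>
  `[< forall q r, s (q * r) = (s q + qact q (s r))%R >].

Definition cocycle2 : {pred Q -> Q -> cen H} := fun c =>
  `[< forall q r s, (qact q (c r s) - c (q * r)%g s + c q (r * s)%g - c q r)%R = 0%R >].

Let subDD (x y z t : cen H) : ((x - y) + (z - t) = (x + z) - (y + t))%R.
Proof. by rewrite opprD addrACA. Qed.
Let subBB (x y z t : cen H) : ((x - y) - (z - t) = (x - z) - (y - t))%R.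
Proof. by rewrite !opprB -!addrA; congr (_ + _)%R; rewrite addrC -addrA addrCA. Qed.

Lemma cocycle1_zmod : zmod_closed cocycle1.
Proof.
split=> [|s t /asboolP hs /asboolP ht]; apply/asboolP => q r.
  by rewrite [RHS]add0r [RHS]raddf0.
by rewrite [LHS]/(s _ - t _)%R hs ht raddfB subDD.
Qed.
HB.instance Definition _ := GRing.isZmodClosed.Build _ cocycle1 cocycle1_zmod.

Lemma cocycle2_zmod : zmod_closed cocycle2.
Proof.
split=> [|c d /asboolP hc /asboolP hd]; apply/asboolP => q r s.
  by rewrite [qact _ _]raddf0 !subr0 addr0.
rewrite (_ : (c - d)%R = fun q r => (c q r - d q r)%R) //.
by rewrite raddfB subBB subDD subBB hc hd subr0.
Qed.
HB.instance Definition _ := GRing.isZmodClosed.Build _ cocycle2 cocycle2_zmod.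

Record Z1 := MkZ1 { z1val :> Q -> cen H; z1valP : z1val \in cocycle1 }.
HB.instance Definition _ := [isSub for z1val].
HB.instance Definition _ := [Choice of Z1 by <:].
HB.instance Definition _ := [SubChoice_isSubZmodule of Z1 by <:].

Record Z2 := MkZ2 { z2val :> Q -> Q -> cen H; z2valP : z2val \in cocycle2 }.
HB.instance Definition _ := [isSub for z2val].
HB.instance Definition _ := [Choice of Z2 by <:].
HB.instance Definition _ := [SubChoice_isSubZmodule of Z2 by <:].

Definition coboundary2 : {pred Z2} := fun c =>
  `[< exists b : Q -> cen H,
      forall q r, c q r = (qact q (b r) - b (q * r)%g + b q)%R >].

Lemma coboundary2_zmod : zmod_closed coboundary2.
Proof.
split=> [|c d /asboolP[b hb] /asboolP[e he]]; apply/asboolP.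
  by exists (fun=> 0%R) => q r; rewrite raddf0 subr0 addr0.
exists (fun q => b q - e q)%R => q r.
by rewrite [LHS]/(c q r - d q r)%R hb he raddfB subBB subDD.
Qed.
HB.instance Definition _ :=
  GRing.isZmodClosed.Build Z2 coboundary2 coboundary2_zmod.

Definition H2 := {ideal_quot coboundary2}.
HB.instance Definition _ := GRing.Zmodule.on H2.

End Cohomology.

Section Compatible.
Variables (H Q : groupType) (Phi : Q -> Out H).

Definition compatible : {pred Aut H * Aut Q} := fun ab =>
  `[< forall q, Phi (ab.2 q) =
        \pi_(Out H) ab.1 * Phi q * (\pi_(Out H) ab.1)^-1 >].

Lemma compatible_group : group_closed compatible.
Proof.
split=> [|u v /asboolP hu /asboolP hv]; apply/asboolP => q.
  by rewrite /= (_ : \pi_(Out H) 1 = 1) ?pi_out_1// mul1g invg1 mulg1.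
have {}hv r : Phi (v.2^-1 r) =
    (\pi_(Out H) v.1)^-1 * Phi r * \pi_(Out H) v.1.
  by rewrite -{2}[r](autKV v.2) hv !mulgA mulVg mul1g mulgVK.
rewrite -[(u / v).2 q]/(u.2 (v.2^-1 q)) -[(u / v).1]/(u.1 / v.1).
by rewrite hu hv pi_outM pi_outV invgM invgK !mulgA.
Qed.

Record compat := MkCompat {
  compat_val :> Aut H * Aut Q; compat_valP : compat_val \in compatible }.
HB.instance Definition _ := [isSub for compat_val].
HB.instance Definition _ := [Choice of compat by <:].
HB.instance Definition _ :=
  SubChoice_isSubGroup.Build _ _ compat compatible_group.

Implicit Types th : compat.

Lemma compatE th q : Phi (th.2 q) =
  \pi_(Out H) th.1 * Phi q * (\pi_(Out H) th.1)^-1.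
Proof. by have /asboolP := compat_valP th. Qed.

Definition cochain2_pull th (c : Q -> Q -> cen H) : Q -> Q -> cen H :=
  fun q r => cen_aut th.1^-1 (c (th.2 q) (th.2 r)).

Lemma qact_compat th q z : qact Phi q (cen_aut th.1^-1 z) =
  cen_aut th.1^-1 (qact Phi (th.2 q) z).
Proof.
rewrite /qact compatE -!cen_outE pi_outV -!cen_outM.
by rewrite !mulgA mulVg mul1g.
Qed.

Lemma cochain2_pull_subproof th (c : Z2 Phi) :
  cochain2_pull th c \in cocycle2 Phi.
Proof.
apply/asboolP => q r s; rewrite /cochain2_pull qact_compat.
rewrite !aut_funM -!raddfB -raddfD -raddfB.
have /asboolP-> := z2valP c; exact: raddf0.
Qed.
Definition Z2_pull th (c : Z2 Phi) : Z2 Phi :=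
  MkZ2 (cochain2_pull_subproof th c).

(* The choice of cocycle is immaterial; see [H2_actE]. *)
Definition H2_act (x : H2 Phi) th : H2 Phi :=
  \pi_(H2 Phi) (Z2_pull th (repr x)).

Lemma H2_actE (c : Z2 Phi) th :
  H2_act (\pi_(H2 Phi) c) th = \pi_(H2 Phi) (Z2_pull th c).
Proof.
apply/eqP; rewrite -Quotient.idealrBE.
have /eqP : repr (\pi_(H2 Phi) c) = c %[mod H2 Phi] by rewrite reprK.
rewrite -Quotient.idealrBE => /asboolP[b hb]; apply/asboolP.
exists (fun q => cen_aut th.1^-1 (b (th.2 q))) => q r.
rewrite [LHS]/(cochain2_pull _ _ q r - cochain2_pull _ _ q r)%R.
rewrite /cochain2_pull qact_compat !aut_funM -!raddfB -raddfD.
by rewrite -hb; exact: (esym (raddfB (cen_aut _) _ _)).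
Qed.

End Compatible.

Record extension (H Q : groupType) := MkExt {
  ext_grp :> groupType;
  ext_inj : {multiplicative H -> ext_grp};
  ext_proj : {multiplicative ext_grp -> Q};
  ext_injP : injective ext_inj;
  ext_projP : forall q, exists g, ext_proj g = q;
  ext_exact : forall g, ext_proj g = 1 <-> exists h, ext_inj h = g }.
Arguments ext_inj {H Q} _.
Arguments ext_proj {H Q} _.

Section Extensions.
Variables H Q : groupType.
Implicit Types E : extension H Q.

(* The automorphism a is unique: it is conjugation by g, restricted to H. *)
Definition associated_hom E (Phi : Q -> Out H) : Prop :=
  forall g : E, exists2 a : Aut H,
    forall h, ext_inj E (a h) = g * ext_inj E h * g^-1
    & Phi (ext_proj E g) = \pi_(Out H) a.

Definition ext_equiv E E' : Prop :=
  exists2 f : {multiplicative E -> E'}, bijective f &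
    (forall h, f (ext_inj E h) = ext_inj E' h) /\
    (forall g, ext_proj E' (f g) = ext_proj E g).

(* A plain predicate: universe constraints rule out [set (extension H Q)]. *)
Definition ext_set := extension H Q -> Prop.

Definition ext_class E : ext_set := fun E' => ext_equiv E E'.

Definition ext_classes (Phi : Q -> Out H) (C : ext_set) : Prop :=
  exists2 E, associated_hom E Phi & C = ext_class E.

End Extensions.

Section FactorSets.
Variables H Q : groupType.
Implicit Types (f : Q -> Q -> H) (phi : Q -> Aut H).

(* The conditions met by phi(q) = conjugation by u(q) and
   f(q,r) = u(q) u(r) u(qr)^-1 for a section u with u(1) = 1; everything is
   written multiplicatively. *)
Record factor_set f phi : Prop := MkFactorSet {
  fs_conj : forall q r,
    phi q * phi r = inner (f q r) * phi (q * r);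
  fs_cocycle : forall q r s,
    f q r * f (q * r) s = phi q (f r s) * f q (r * s);
  fs_1l : forall q, f 1 q = 1;
  fs_1r : forall q, f q 1 = 1 }.

Section Group.
Variables (f : Q -> Q -> H) (phi : Q -> Aut H) (fs : factor_set f phi).

Definition fs_type of factor_set f phi : Type := (H * Q)%type.
Local Notation T := (fs_type fs).
HB.instance Definition _ := Choice.copy T (H * Q)%type.

Lemma fs_phi1 : phi 1 = 1.
Proof.
apply: (mulgI (phi 1)); rewrite (fs_conj fs) (fs_1l fs) inner1 mul1g.
by rewrite !mulg1.
Qed.

Definition fs_one : T := (1, 1).
Definition fs_mul (x y : T) : T :=
  (x.1 * phi x.2 y.1 * f x.2 y.2, x.2 * y.2).
Definition fs_inv (x : T) : T :=
  ((phi x.2^-1 x.1 * f x.2^-1 x.2)^-1, x.2^-1).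

Lemma fs_mulA : associative fs_mul.
Proof.
move=> [n q] [m r] [p s]; congr (_, _) => /=; last by rewrite mulgA.
rewrite !aut_funM -!mulgA; congr (_ * (_ * _)).
have /(congr1 (fun a : Aut H => a p)) := fs_conj fs q r.
rewrite !autM /= /inner_fun => ->.
by rewrite -(fs_cocycle fs) !mulgA mulgVK.
Qed.
Lemma fs_mul1 : left_id fs_one fs_mul.
Proof.
by move=> [n q]; rewrite /fs_mul /= fs_phi1 aut1 (fs_1l fs) mulg1 !mul1g.
Qed.
Lemma fs_mulr1 : right_id fs_one fs_mul.
Proof. by move=> [n q]; rewrite /fs_mul /= hom1 (fs_1r fs) !mulg1. Qed.
Lemma fs_mulV : left_inverse fs_one fs_inv fs_mul.
Proof. by move=> [n q]; rewrite /fs_mul /= -mulgA mulVg mulVg. Qed.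
Lemma fs_mulrV : right_inverse fs_one fs_inv fs_mul.
Proof.
move=> x; rewrite -[fs_mul x _]fs_mul1 -(fs_mulV (fs_inv x)) -fs_mulA.
by rewrite (fs_mulA _ x) fs_mulV fs_mul1.
Qed.

HB.instance Definition _ :=
  isGroup.Build T fs_mulA fs_mul1 fs_mulr1 fs_mulV fs_mulrV.

Definition fs_inj (h : H) : T := (h, 1).
Definition fs_proj (x : T) : Q := x.2.

Lemma fs_injM : {morph fs_inj : x y / x * y}.
Proof.
move=> x y; congr (_, _); last by rewrite mulg1.
by rewrite /= fs_phi1 aut1 (fs_1l fs) mulg1.
Qed.
HB.instance Definition _ := isMultiplicative.Build H T fs_inj fs_injM.

Lemma fs_projM : {morph fs_proj : x y / x * y}. Proof. by []. Qed.
HB.instance Definition _ := isMultiplicative.Build T Q fs_proj fs_projM.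

Lemma fs_injP : injective fs_inj. Proof. by move=> x y []. Qed.
Lemma fs_projP q : exists g, fs_proj g = q. Proof. by exists (1, q). Qed.
Lemma fs_exact g : fs_proj g = 1 <-> exists h, fs_inj h = g.
Proof.
split=> [|[h <-] //]; case: g => h q; rewrite /fs_proj /= => ->.
by exists h.
Qed.

Definition fs_ext : extension H Q :=
  @MkExt H Q T fs_inj fs_proj fs_injP fs_projP fs_exact.
End Group.

Lemma factor_set_push f phi (a : Aut H) : factor_set f phi ->
  factor_set (fun q r => a (f q r)) (fun q => a * phi q * a^-1).
Proof.
case=> hphi hc h1l h1r; split=> [q r|q r s|q|q].
- rewrite !mulgA mulgVK -(mulgA a) hphi !mulgA innerJ.
  by [].
- by rewrite -aut_funM hc aut_funM !autM autVK.
- by rewrite h1l hom1.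
- by rewrite h1r hom1.
Qed.

Lemma factor_set_add f phi (Phi : Q -> Out H) (c : Z2 Phi) :
    factor_set f phi -> (forall q, \pi_(Out H) (phi q) = Phi q) ->
    (forall q, c 1 q = 0%R /\ c q 1 = 0%R) ->
  factor_set (fun q r => f q r * cval (c q r)) phi.
Proof.
case=> hphi hc h1l h1r hPhi hn; split=> [q r|q r s|q|q].
- rewrite hphi; congr (_ * _); apply: autP => x.
  rewrite /= /inner_fun -(mulgA (f q r) (cval _)) cenP invgM !mulgA.
  by rewrite mulgK.
- have /asboolP/(_ q r s) := z2valP c.
  rewrite /qact -hPhi cen_outE => /eqP; rewrite subr_eq0 addrAC subr_eq.
  move=> /eqP/(congr1 (@cval H)); rewrite !cvalD /= => hcc.
  rewrite aut_funM -mulgA (mulgA (cval _)) (cenP (c q r) (f _ _)).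
  rewrite -(mulgA (f (q * r) s)) -hcc !mulgA hc.
  rewrite -[in RHS](mulgA (phi q (f r s)) (phi q (cval _))).
  by have /= -> := cenP (cen_aut (phi q) (c r s)) (f q (r * s)); rewrite !mulgA.
- by rewrite h1l (hn q).1 cval0 mulg1.
- by rewrite h1r (hn q).2 cval0 mulg1.
Qed.

End FactorSets.

Section Pullback.
Variables (H Q Q' : groupType) (beta : {multiplicative Q' -> Q}).
Variable E : extension H Q.

Definition pb_pred : {pred E * Q'} := fun x => ext_proj E x.1 == beta x.2.

Lemma pb_group : group_closed pb_pred.
Proof.
split=> [|x y]; rewrite !unfold_in /pb_pred /=; first by rewrite !hom1.
by move=> /eqP hx /eqP hy; rewrite !gmulfM !homV hx hy.
Qed.

Record pb_type := MkPb { pb_val : E * Q'; pb_valP : pb_val \in pb_pred }.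
HB.instance Definition _ := [isSub for pb_val].
HB.instance Definition _ := [Choice of pb_type by <:].
HB.instance Definition _ :=
  SubChoice_isSubGroup.Build _ _ pb_type pb_group.

Lemma pb_inj_subproof h : (ext_inj E h, 1) \in pb_pred.
Proof.
rewrite unfold_in /pb_pred /= hom1; apply/eqP/(ext_exact (ext_inj E h)).
by exists h.
Qed.
Definition pb_inj (h : H) : pb_type := MkPb (pb_inj_subproof h).
Lemma pb_injM : {morph pb_inj : x y / x * y}.
Proof.
by move=> x y; apply: val_inj; congr (_, _); rewrite ?mulg1 //= gmulfM.
Qed.
HB.instance Definition _ := isMultiplicative.Build H pb_type pb_inj pb_injM.

Definition pb_proj (x : pb_type) : Q' := (pb_val x).2.
Lemma pb_projM : {morph pb_proj : x y / x * y}. Proof. by []. Qed.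
HB.instance Definition _ := isMultiplicative.Build pb_type Q' pb_proj pb_projM.

Lemma pb_injP : injective pb_inj.
Proof. by move=> x y [/ext_injP]. Qed.
Lemma pb_projP q : exists x, pb_proj x = q.
Proof.
have [g hg] := ext_projP E (beta q).
have hx : (g, q) \in pb_pred by apply/eqP.
by exists (MkPb hx).
Qed.
Lemma pb_exact x : pb_proj x = 1 <-> exists h, pb_inj h = x.
Proof.
split=> [|[h <-] //]; case: x => [[g q] hx]; rewrite /pb_proj /= => q1.
have /ext_exact[h hg] : ext_proj E g = 1 by rewrite (eqP hx) /= q1 hom1.
by exists h; apply: val_inj; rewrite /= hg q1.
Qed.

Definition pb_ext : extension H Q' :=
  @MkExt H Q' pb_type pb_inj pb_proj pb_injP pb_projP pb_exact.
End Pullback.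

Section ClassOperations.
Variables H Q : groupType.
Implicit Types (C : ext_set H Q) (Phi : Q -> Out H).

Definition class_push (a : Aut H) C : ext_set H Q := fun E' =>
  exists f phi (fs : factor_set f phi),
    C (fs_ext fs) /\ ext_equiv (fs_ext (factor_set_push a fs)) E'.

Definition class_pull (Q' : groupType) (beta : {multiplicative Q' -> Q}) C :
    ext_set H Q' := fun E' =>
  exists2 E, C E & ext_equiv (pb_ext beta E) E'.

Definition class_compat Phi C (th : compat Phi) : ext_set H Q :=
  class_push th.1^-1 (class_pull (aut_fun th.2) C).

(* Factor sets are normalized, so f + c is one only if c is normalized too;
   every class of H^2 has a normalized representative. *)
Definition class_H2 Phi C (x : H2 Phi) : ext_set H Q := fun E' =>
  exists f phi (fs : factor_set f phi)
         (hphi : forall q, \pi_(Out H) (phi q) = Phi q)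
         (c : Z2 Phi) (hc : forall q, c 1 q = 0%R /\ c q 1 = 0%R),
    [/\ C (fs_ext fs), \pi_(H2 Phi) c = x &
        ext_equiv (fs_ext (factor_set_add fs hphi hc)) E'].

(* The set is a singleton when C and C' are in X_Phi, as H^2 acts simply
   transitively there; 0 is a dummy value for other arguments. *)
Definition class_diff Phi C C' : H2 Phi :=
  xget 0%R [set x | exists C0 y y',
    [/\ ext_classes Phi C0, C = class_H2 C0 y, C' = class_H2 C0 y' &
        x = (y - y')%R]].

Definition lambda Phi (E : extension H Q) (th : compat Phi) : H2 Phi :=
  class_diff Phi (ext_class E) (class_compat (ext_class E) th).

End ClassOperations.

Section AutRel.
Variables (H Q : groupType) (E : extension H Q).

Definition restricts : {pred Aut E} := fun g =>
  `[< exists a : Aut H, forall h, g (ext_inj E h) = ext_inj E (a h) >].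

Lemma restricts_group : group_closed restricts.
Proof.
split=> [|u v /asboolP[a ha] /asboolP[b hb]]; apply/asboolP.
  by exists 1 => h.
exists (a / b) => h; rewrite !autM -ha; congr (u _).
by rewrite -{1}[h](autKV b) -hb autVK.
Qed.

Record AutRel := MkAutRel {
  autrel_val :> Aut E; autrel_valP : autrel_val \in restricts }.
HB.instance Definition _ := [isSub for autrel_val].
HB.instance Definition _ := [Choice of AutRel by <:].
HB.instance Definition _ :=
  SubChoice_isSubGroup.Build _ _ AutRel restricts_group.

End AutRel.

(* Main.v *)
Require Import Defs.
From HB Require Import structures.
From mathcomp Require Import all_boot ssralg ring_quotient.
From mathcomp Require Import boolp classical_sets functions.

Set Implicit Arguments.
Unset Strict Implicit.
Unset Printing Implicit Defensive.

Local Open Scope group_scope.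

(** The proof replaces every construction on classes of extensions by one on
    the middle groups themselves.

    A normalized section of an extension produces a factor set [(f, phi)]; the
    relation [presents E f phi] records this, and two extensions presented by
    the same factor set are equivalent ([presents_ext_equiv]).  Extensions with
    the same outer action can be presented with the same [phi]
    ([presents_lift]), and then their [f]'s differ by a 2-cocycle [c] with
    central values; the relation [differs_by E E' x] says that E' is E
    translated by the class x of such a c.  A change of sections changes [c] by
    a coboundary ([differs_by_uniq]), so x is a function of E and E': it is the
    difference of their classes ([class_diffP]), it is additive
    ([differs_by_add]), and it vanishes exactly when the extensions are
    equivalent ([differs_by0]).

    For a compatible pair (alpha, beta), the class of
    (alpha^-1)_* beta^* E is that of a very concrete extension: the same group
    G with the inclusion i o alpha and the projection beta^-1 o pi
    ([twist], [class_compatE]).  The rest follows: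
    - lambda_E(theta) = x means that E is its own twist translated by x
      ([lambdaP]);
    - twisting twice is twisting by the product ([twist_mul]) and twisting
      transports differences through the action on H^2 ([differs_by_twist]), so
      the identity E - E theta theta' = (E - E theta') + (E - E theta) theta'
      says that lambda_E is a derivation;
    - lambda_E(theta) = 0 means that E and its twist are equivalent, and an
      equivalence between them is precisely (the inverse of) an automorphism of
      G inducing alpha on H and beta on Q ([lambda_eq0]).

    Exactness on the left is elementary: an automorphism g that is trivial on H
    and on Q has the form g(x) = k(x) x with k(x) in H; comparing g(x h) and
    g(h' x) with h' = x h x^-1 shows that k(x) is central and depends only on
    pi(x), and multiplicativity of g is the cocycle identity for k
    ([trivial_restriction]). *)

(** * Sections and factor sets *)

Section Presentations.
Local Open Scope quotient_scope.
Variables H Q : groupType.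
Implicit Types (E : extension H Q) (f : Q -> Q -> H) (phi : Q -> Aut H).

Lemma ext_equiv_intro E E' (F : E -> E') (G : E' -> E) :
    {morph F : x y / x * y} -> cancel F G -> cancel G F ->
    (forall h, F (ext_inj E h) = ext_inj E' h) ->
    (forall g, ext_proj E' (F g) = ext_proj E g) ->
  ext_equiv E E'.
Proof.
move=> FM FK GK Fi Fp.
pose F' : {multiplicative E -> E'} :=
  HB.pack F (isMultiplicative.Build E E' F FM).
by exists F'; [exists G | split].
Qed.

Lemma ext_equiv_sym E E' : ext_equiv E E' -> ext_equiv E' E.
Proof.
case=> F [G FK GK] [Fi Fp]; apply: (@ext_equiv_intro _ _ G F) => //.
- by move=> x y; apply: (can_inj FK); rewrite gmulfM !GK.
- by move=> h; rewrite -Fi FK.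
- by move=> g; rewrite -Fp GK.
Qed.

Lemma ext_equiv_trans E E' E'' :
  ext_equiv E E' -> ext_equiv E' E'' -> ext_equiv E E''.
Proof.
case=> F [G FK GK] [Fi Fp] [F' [G' FK' GK'] [Fi' Fp']].
apply: (@ext_equiv_intro _ _ (F' \o F) (G \o G')).
- by move=> x y /=; rewrite !gmulfM.
- exact: can_comp.
- exact: can_comp.
- by move=> h /=; rewrite Fi Fi'.
- by move=> g /=; rewrite Fp' Fp.
Qed.

Lemma proj_inj E h : ext_proj E (ext_inj E h) = 1.
Proof. by apply/ext_exact; exists h. Qed.

(** The conjugation and product rules avoid inverses, so that words in E can be
    rewritten into the form i(h) u(q). *)
Record normal_section E (u : Q -> E) f phi : Prop := NormalSection {
  sec_1 : u 1 = 1;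
  sec_proj : forall q, ext_proj E (u q) = q;
  sec_conj : forall q h, u q * ext_inj E h = ext_inj E (phi q h) * u q;
  sec_mul : forall q r, u q * u r = ext_inj E (f q r) * u (q * r) }.

Definition presents E f phi : Prop := exists u : Q -> E, normal_section u f phi.

(** A section turns E into the set H * Q; the factor [k] is the coordinate in
    H. *)
Lemma section_decomp E (u : Q -> E) : (forall q, ext_proj E (u q) = q) ->
  exists k : E -> H, forall g, g = ext_inj E (k g) * u (ext_proj E g).
Proof.
move=> up; have [g|k kE] :=
  @boolp.choice _ _ (fun g h => g = ext_inj E h * u (ext_proj E g)).
  have [|h hE] := (ext_exact (g * (u (ext_proj E g))^-1)).1.
    by rewrite gmulfM homV up mulgV.
  by exists h; rewrite hE mulgVK.
by exists k.
Qed.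

Lemma mul_inj_l E h k (x : E) : ext_inj E h * x = ext_inj E k * x -> h = k.
Proof. by move=> /mulIg/ext_injP. Qed.

(** The two identities of a factor set come from evaluating u(q) u(r) h and
    u(q) u(r) u(s) in two ways. *)
Lemma presents_factor_set E f phi : presents E f phi -> factor_set f phi.
Proof.
case=> u [u1 up uc um]; split=> [q r|q r s|q|q].
- apply: autP => h; rewrite !autM /= /inner_fun; apply: (mulIg (f q r)).
  rewrite mulgVK; apply: (@mul_inj_l E _ _ (u (q * r))).
  by rewrite !gmulfM -!mulgA -um -uc !mulgA -um -!mulgA uc !mulgA uc.
- apply: (@mul_inj_l E _ _ (u (q * r * s))).
  rewrite !gmulfM -mulgA -um mulgA -um -(mulgA q r) -[in RHS]mulgA -um.
  by rewrite [in RHS]mulgA -uc -[in RHS]mulgA -um mulgA.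
- apply: (@mul_inj_l E _ _ (u q)).
  by rewrite -{2}[q]mul1g -um u1 hom1.
- apply: (@mul_inj_l E _ _ (u q)).
  by rewrite -{2}[q]mulg1 -um u1 hom1 mulg1 mul1g.
Qed.

Lemma presents_fs f phi (fs : factor_set f phi) : presents (fs_ext fs) f phi.
Proof.
exists (fun q => (1, q) : fs_type fs); split=> //.
- move=> q h; congr (_, _); rewrite /= ?mul1g ?mulg1 //.
  by rewrite (fs_1r fs) (fs_1l fs) hom1 !mulg1.
- move=> q r; congr (_, _); rewrite /= ?mul1g //.
  by rewrite !hom1 !mul1g mulg1 (fs_1l fs) mulg1.
Qed.

Lemma presents_equiv E E' f phi :
  ext_equiv E E' -> presents E f phi -> presents E' f phi.
Proof.
case=> F _ [Fi Fp] [u [u1 up uc um]]; exists (F \o u); split=> /=.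
- by rewrite u1 hom1.
- by move=> q; rewrite Fp.
- by move=> q h; rewrite -!Fi -!gmulfM uc.
- by move=> q r; rewrite -!Fi -!gmulfM um.
Qed.

(** Both groups have coordinates in H * Q in which the product is given by the
    factor set, so matching coordinates is an isomorphism. *)
Lemma presents_ext_equiv E E' f phi :
  presents E f phi -> presents E' f phi -> ext_equiv E E'.
Proof.
case=> u [u1 up uc um] [v [v1 vp vc vm]].
have [k kE] := section_decomp up; have [l lE] := section_decomp vp.
pose F g := ext_inj E' (k g) * v (ext_proj E g).
pose G g := ext_inj E (l g) * u (ext_proj E' g).
have Fp g : ext_proj E' (F g) = ext_proj E g.
  by rewrite gmulfM proj_inj mul1g vp.
have Gp g : ext_proj E (G g) = ext_proj E' g.
  by rewrite gmulfM proj_inj mul1g up.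
have lF g : l (F g) = k g.
  by apply: (@mul_inj_l E' _ _ (v (ext_proj E g))); rewrite -{1}Fp -lE.
have kG g : k (G g) = l g.
  by apply: (@mul_inj_l E _ _ (u (ext_proj E' g))); rewrite -{1}Gp -kE.
apply: (@ext_equiv_intro _ _ F G) => //.
- move=> x y; have kM : k (x * y) = k x * phi (ext_proj E x) (k y)
      * f (ext_proj E x) (ext_proj E y).
    apply: (@mul_inj_l E _ _ (u (ext_proj E (x * y)))); rewrite -kE.
    rewrite {1}[x]kE {1}[y]kE !gmulfM -!mulgA -um; congr (_ * _).
    by rewrite !mulgA uc.
  rewrite /F kM !gmulfM -!mulgA -vm; congr (_ * _).
  by rewrite !mulgA vc.
- by move=> g; rewrite /G lF Fp -kE.
- by move=> g; rewrite /F kG Gp -lE.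
- move=> h; rewrite /F proj_inj v1 mulg1; congr (ext_inj E' _).
  by apply: (@mul_inj_l E _ _ 1); rewrite -{1}u1 -(proj_inj E h) -kE mulg1.
Qed.

(** Two sections differ by a function b with values in H, v = b u; this
    determines how their factor sets are related. *)
Lemma change_section E (u v : Q -> E) f phi f' phi' :
    normal_section u f phi -> normal_section v f' phi' ->
  exists b : Q -> H, (forall q, phi' q = inner (b q) * phi q) /\
    forall q r, f' q r * b (q * r)%g = b q * phi q (b r) * f q r.
Proof.
case=> u1 up uc um [v1 vp vc vm]; have [k kE] := section_decomp up.
have {}kE q : v q = ext_inj E (k (v q)) * u q by rewrite -{3}[q]vp -kE.
exists (k \o v); split=> [q|q r] /=.
  apply: autP => h; rewrite autM /= /inner_fun; apply: (mulIg (k (v q))).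
  rewrite mulgVK; apply: (@mul_inj_l E _ _ (u q)).
  by rewrite !gmulfM -!mulgA -kE -uc -vc mulgA -kE.
apply: (@mul_inj_l E _ _ (u (q * r))).
rewrite !gmulfM -!mulgA -kE -um -vm {1}kE {1}[v r]kE -!mulgA.
by congr (_ * _); rewrite !mulgA uc.
Qed.

(** Conversely, every such b with b(1) = 1 is realized by the section b u. *)
Lemma presents_change E f phi (b : Q -> H) : b 1 = 1 -> presents E f phi ->
  presents E (fun q r => b q * phi q (b r) * f q r * (b (q * r)%g)^-1)
    (fun q => inner (b q) * phi q).
Proof.
move=> b1 [u [u1 up uc um]]; exists (fun q => ext_inj E (b q) * u q); split.
- by rewrite b1 hom1 u1 mulg1.
- by move=> q; rewrite gmulfM proj_inj up mul1g.
- move=> q h; rewrite autM /= /inner_fun !gmulfM homV -!mulgA mulKg.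
  by rewrite uc.
- move=> q r; rewrite !gmulfM homV -!mulgA mulKg -um; congr (_ * _).
  by rewrite !mulgA uc.
Qed.

(** The outer action can be read off a single section, since conjugation by
    h u(q) differs from conjugation by u(q) by an inner automorphism. *)
Lemma presentsP E (Phi : Q -> Out H) : associated_hom E Phi <->
  exists f phi, (forall q, \pi_(Out H) (phi q) = Phi q) /\ presents E f phi.
Proof.
split=> [hPhi|[f [phi [hphi [u [u1 up uc um]]]]] g]; last first.
  have [k kE] := section_decomp up.
  exists (inner (k g) * phi (ext_proj E g)) => [h|].
    rewrite autM /= /inner_fun !gmulfM homV [in RHS](kE g) invgM !mulgA.
    by rewrite -(mulgA _ (u _) (ext_inj _ _)) uc !mulgA mulgK.
  rewrite -hphi; apply/eqP; rewrite eq_sym; apply/outP.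
  by exists (k g).
have [u up] : exists u : Q -> E, u 1 = 1 /\ forall q, ext_proj E (u q) = q.
  have [u up] := boolp.choice (@ext_projP H Q E).
  (* u(1) lies in H, so this renormalization is still a section. *)
  exists (fun q => (u 1)^-1 * u q); split=> [|q]; first by rewrite mulVg.
  by rewrite gmulfM homV !up invg1 mul1g.
case: up => u1 up; have [k kE] := section_decomp up.
have /boolp.choice[phi hphi] q : exists a : Aut H,
    (forall h, ext_inj E (a h) = u q * ext_inj E h * (u q)^-1) /\
    \pi_(Out H) a = Phi q.
  by have [a ha1] := hPhi (u q); rewrite up => ->; exists a.
exists (fun q r => k (u q * u r)), phi; split=> [q|].
  by case: (hphi q).
exists u; split=> // [q h|q r].
  by rewrite (hphi q).1 mulgVK.
by rewrite {1}[u q * u r]kE gmulfM !up.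
Qed.

(** Multiplying a section by elements of H realizes every lift of the outer
    action to [Aut H] that is trivial at 1: this is what makes it possible to
    present all extensions in question with one and the same [phi]. *)
Lemma presents_lift E (Phi : Q -> Out H) (phi : Q -> Aut H) :
    associated_hom E Phi -> (forall q, \pi_(Out H) (phi q) = Phi q) ->
    phi 1 = 1 ->
  exists f, presents E f phi.
Proof.
move=> /presentsP[f [psi [hpsi hE]]] hphi phi1.
have /boolp.choice[b hb] q : exists h, phi q = inner h * psi q /\ (q = 1 -> h = 1).
  have [->|q1] := pselect (q = 1).
    exists 1; split=> //; rewrite inner1 mul1g phi1.
    by rewrite (fs_phi1 (presents_factor_set hE)).
  have /eqP/outP[h hh] : phi q = psi q %[mod Out H] by rewrite hphi hpsi.
  by exists h.
exists (fun q r => b q * psi q (b r) * f q r * (b (q * r)%g)^-1).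
have -> : phi = fun q => inner (b q) * psi q.
  by apply/funext => q; case: (hb q).
by apply: presents_change => //; apply: (hb 1).2.
Qed.
End Presentations.

(** * Differences of extensions in H^2 *)

Section Differences.
Import GRing.Theory.
Local Open Scope quotient_scope.
Variables (H Q : groupType) (Phi : Q -> Out H).
Implicit Types (E : extension H Q) (f : Q -> Q -> H) (phi : Q -> Aut H).
Implicit Types (c : Z2 Phi) (x y : H2 Phi).

Lemma cval_inj : injective (@cval H).
Proof. exact: val_inj. Qed.

Lemma cval_qact phi q z : \pi_(Out H) (phi q) = Phi q ->
  cval (qact Phi q z) = phi q (cval z).
Proof. by rewrite /qact => <-; rewrite cen_outE. Qed.

Lemma H2_eqP c d : \pi_(H2 Phi) c = \pi_(H2 Phi) d <->
  exists b : Q -> cen H, forall q r,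
    c q r = (d q r + (qact Phi q (b r) - b (q * r)%g + b q))%R.
Proof.
have subE q r : (c - d)%R q r = (c q r - d q r)%R by [].
split=> [/eqP|[b hb]].
  rewrite -Quotient.idealrBE => /asboolP[b hb].
  by exists b => q r; rewrite -hb subE addrC subrK.
apply/eqP; rewrite -Quotient.idealrBE; apply/asboolP.
by exists b => q r; rewrite subE hb addrC addKr.
Qed.

Lemma inner_eq_central (h k : H) :
  inner h = inner k -> h^-1 * k \in @central H.
Proof.
move=> hk; apply: cenI => y.
have := congr1 (fun a : Aut H => h^-1 * a y * k) hk.
by rewrite /= /inner_fun !mulgA mulVg mul1g mulgVK.
Qed.

Lemma mulg_cen (h k : H) (z t : cen H) :
  h * cval z * (k * cval t) = h * k * cval (z + t)%R.
Proof. by rewrite cvalD -!mulgA [cval z * (k * _)]mulgA (cenP z k) -!mulgA. Qed.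

(** Both f and f' describe the same composites phi(q) phi(r), so f and f' have
    the same inner automorphisms and f^-1 f' is central; dividing the cocycle
    identity for f' by that for f gives the cocycle identity for f^-1 f'. *)
Lemma factor_set_sub f f' phi : (forall q, \pi_(Out H) (phi q) = Phi q) ->
    factor_set f phi -> factor_set f' phi ->
  exists c, forall q r, f' q r = f q r * cval (c q r).
Proof.
move=> hphi fs fs'.
have fc q r : (f q r)^-1 * f' q r \in @central H.
  apply: inner_eq_central; apply: (mulIg (phi (q * r))).
  by rewrite -(fs_conj fs) -(fs_conj fs').
pose c q r := MkCen (fc q r).
have cE q r : f' q r = f q r * cval (c q r) by rewrite mulVKg.
have cc : c \in cocycle2 Phi.
  apply/asboolP => q r s; apply/eqP; rewrite subr_eq0 addrAC subr_eq; apply/eqP.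
  apply: cval_inj.
  have := fs_cocycle fs' q r s.
  rewrite !cE aut_funM -(cval_qact _ (hphi q)) !mulg_cen (fs_cocycle fs).
  by move/mulgI => ->.
by exists (MkZ2 cc).
Qed.

(** E' lies in the class obtained from that of E by the action of x. *)
Definition differs_by E E' x : Prop := exists f phi c,
  [/\ forall q, \pi_(Out H) (phi q) = Phi q, presents E f phi,
      presents E' (fun q r => f q r * cval (c q r)) phi & \pi_(H2 Phi) c = x].

(** Passing to other sections multiplies the old ones by functions b for E and
    b' for E'.  Since the old sections share [phi], and so do the new ones,
    b and b' induce the same inner automorphisms; hence b' = b z with z
    central, and the two cocycles differ by the coboundary of z. *)
Lemma differs_by_uniq E E' x y : differs_by E E' x -> differs_by E E' y -> x = y.
Proof.
case=> f [phi [c [hphi [u hu] [u' hu'] <-]]].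
case=> f1 [phi1 [c1 [hphi1 [v hv] [v' hv'] <-]]].
have [b [hb fb]] := change_section hu hv.
have [b' [hb' fb']] := change_section hu' hv'.
have bz q : (b q)^-1 * b' q \in @central H.
  apply: inner_eq_central; apply: (mulIg (phi q)).
  by rewrite -hb -hb'.
pose z q := MkCen (bz q).
have zE q : b' q = b q * cval (z q) by rewrite mulVKg.
symmetry; apply/H2_eqP; exists z => q r.
suff key : (c1 q r + z (q * r)%g = z q + qact Phi q (z r) + c q r)%R.
  rewrite (canRL (addrK _) key) addrAC [RHS]addrC; congr (_ + _)%R.
  by rewrite -addrA addrC.
apply: cval_inj; apply: (mulgI (f1 q r * b (q * r)%g)).
rewrite -mulg_cen -zE fb' !zE aut_funM.
by rewrite -(cval_qact _ (hphi q)) !mulg_cen fb.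
Qed.

Lemma differs_by_assoc E E' x :
  differs_by E E' x -> associated_hom E Phi /\ associated_hom E' Phi.
Proof.
case=> f [phi [c [hphi hE hE' _]]].
by split; apply/presentsP; [exists f, phi|exists (fun q r => f q r * cval (c q r)), phi].
Qed.

Lemma differs_by_ex E E' : associated_hom E Phi -> associated_hom E' Phi ->
  exists x, differs_by E E' x.
Proof.
move=> /presentsP[f [phi [hphi hf]]] hE'; have fs := presents_factor_set hf.
have [f' hf'] := presents_lift hE' hphi (fs_phi1 fs).
have [c cE] := factor_set_sub hphi fs (presents_factor_set hf').
exists (\pi_(H2 Phi) c); exists f, phi, c; split=> //.
by congr (presents E' _ phi): hf'; apply/funext => q; apply/funext => r.
Qed.

(** Presenting E'' with the [phi] that already serves E and E' makes the
    cocycles literally add up. *)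
Lemma differs_by_add E E' E'' x y :
  differs_by E E' x -> differs_by E' E'' y -> differs_by E E'' (x + y)%R.
Proof.
case=> f [phi [c [hphi hE hE' cx]]] dy.
have [aE' aE''] := differs_by_assoc dy.
have phi1 := fs_phi1 (presents_factor_set hE).
have [f'' hE''] := presents_lift aE'' hphi phi1.
have [d dE] := factor_set_sub hphi (presents_factor_set hE') (presents_factor_set hE'').
have yE : y = \pi_(H2 Phi) d.
  apply: (differs_by_uniq dy); exists (fun q r => f q r * cval (c q r)), phi, d.
  split=> //; congr (presents E'' _ phi): hE''.
  by apply/funext => q; apply/funext => r.
exists f, phi, (c + d)%R; split=> //; last by rewrite yE -cx raddfD.
congr (presents E'' _ phi): hE''; apply/funext => q; apply/funext => r.
by rewrite dE mulgA.
Qed.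

(** If the cocycle is the coboundary of b, then replacing the section u' of E'
    by b^-1 u' gives it the factor set of E. *)
Lemma differs_by0 E E' : associated_hom E Phi ->
  differs_by E E' 0%R <-> ext_equiv E E'.
Proof.
move=> aE; split=> [|eqEE']; last first.
  have /presentsP[f [phi [hphi hE]]] := aE.
  exists f, phi, 0%R; split=> //; last by rewrite raddf0.
  have := presents_equiv eqEE' hE; congr (presents E' _ phi).
  by apply/funext => q; apply/funext => r; rewrite mulg1.
case=> f [phi [c [hphi hE hE' c0]]].
have [b bE] : exists b : Q -> cen H, forall q r,
    c q r = (qact Phi q (b r) - b (q * r)%g + b q)%R.
  have [|b bE] := (H2_eqP c 0%R).1; first by rewrite c0 raddf0.
  by exists b => q r; rewrite bE add0r.
have fs := presents_factor_set hE; have fs' := presents_factor_set hE'.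
have b1 : cval (b 1) = 1.
  (* c is normalized, and its coboundary formula at (1, 1) reduces to b(1). *)
  have := fs_1l fs' 1; rewrite (fs_1l fs) mul1g bE mulg1 subrK.
  by rewrite (cval_qact _ (hphi 1)) (fs_phi1 fs).
apply: (presents_ext_equiv hE).
have := presents_change (b := fun q => (cval (b q))^-1) _ hE'.
rewrite b1 invg1 => /(_ erefl).
congr (presents E' _ _); apply/funext => q; last first.
  apply: autP => x; rewrite autM /= /inner_fun.
  by rewrite -cvalN cenP mulgK.
apply/funext => r; rewrite -!cvalN -(cval_qact _ (hphi q)).
rewrite opprK -cvalD cenP -!mulgA -!cvalD bE.
have -> : qact Phi q (- b r)%R = (- qact Phi q (b r))%R by exact: raddfN.
rewrite [X in cval X](_ : _ = 0%R) ?mulg1 //.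
by rewrite addrA addrK addrC addrA addrAC addrK addNr.
Qed.

Lemma class_H2E E x : class_H2 (ext_class E) x = differs_by E ^~ x.
Proof.
apply/funext => E'; apply/propext; split.
  case=> f [phi [fs [hphi [c [hc [eqE cx eqE']]]]]]; exists f, phi, c; split=> //.
    exact: presents_equiv (ext_equiv_sym eqE) (presents_fs fs).
  exact: presents_equiv eqE' (presents_fs _).
case=> f [phi [c [hphi hE hE' cx]]].
have fs := presents_factor_set hE; have fs' := presents_factor_set hE'.
have hc q : c 1 q = 0%R /\ c q 1 = 0%R.
  split; apply: cval_inj.
    by have := fs_1l fs' q; rewrite (fs_1l fs) mul1g.
  by have := fs_1r fs' q; rewrite (fs_1r fs) mul1g.
exists f, phi, fs, hphi, c, hc; split=> //.
  exact: presents_ext_equiv hE (presents_fs fs).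
exact: presents_ext_equiv (presents_fs _) hE'.
Qed.

(** Subtracting relative to any basepoint E0 gives the same class, by
    additivity; for existence, E itself is a basepoint. *)
Lemma class_diffP E E' x : differs_by E' E x ->
  class_diff Phi (ext_class E) (ext_class E') = x.
Proof.
move=> d; have [aE' aE] := differs_by_assoc d.
have ext_refl E0 : ext_equiv E0 E0 by apply: (@ext_equiv_intro _ _ _ _ id id).
apply: xget_unique.
  exists (ext_class E), 0%R, (- x)%R; split; last by rewrite sub0r opprK.
  - by exists E.
  - rewrite class_H2E; apply/funext => E0; apply/propext.
    exact: iff_sym (differs_by0 _ aE).
  - have [y dy] := differs_by_ex aE aE'.
    have yE : y = (- x)%R.
      apply/eqP; rewrite -addr_eq0; apply/eqP.
      apply: (differs_by_uniq (differs_by_add dy d)).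
      exact/differs_by0.
    rewrite class_H2E -yE; apply/funext => E0; apply/propext; split=> h.
      have := differs_by_add dy ((differs_by0 E0 aE').2 h).
      by rewrite addr0.
    apply/(differs_by0 _ aE').
    have := differs_by_add d h.
    by rewrite yE subrr.
move=> _ [_ [y [y' [[E0 aE0 ->] + + ->]]]].
rewrite !class_H2E => /(congr1 (@^~ E)) dy /(congr1 (@^~ E')) dy'.
have {}dy : differs_by E0 E y by rewrite -dy; exact: ext_refl.
have {}dy' : differs_by E0 E' y' by rewrite -dy'; exact: ext_refl.
have := differs_by_uniq dy (differs_by_add dy' d).
by move=> ->; rewrite addrAC subrr add0r.
Qed.

End Differences.

(** * The action of compatible pairs *)

Section Twist.
Import GRing.Theory.
Local Open Scope quotient_scope.
Variables H Q : groupType.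
Implicit Types (E : extension H Q) (f : Q -> Q -> H) (phi : Q -> Aut H).
Implicit Types (a : Aut H) (b : Aut Q).

Section TwistedExtension.
Variables (E : extension H Q) (a : Aut H) (b : Aut Q).

Definition twist_inj (h : H) : E := ext_inj E (a h).
Definition twist_proj (g : E) : Q := b^-1 (ext_proj E g).

Lemma twist_injM : {morph twist_inj : x y / x * y}.
Proof. by move=> x y; rewrite /twist_inj !gmulfM. Qed.
HB.instance Definition _ := isMultiplicative.Build H E twist_inj twist_injM.

Lemma twist_projM : {morph twist_proj : x y / x * y}.
Proof. by move=> x y; rewrite /twist_proj !gmulfM. Qed.
HB.instance Definition _ := isMultiplicative.Build E Q twist_proj twist_projM.

Lemma twist_injP : injective twist_inj.
Proof. by move=> x y /ext_injP/(can_inj (@aut_funK _ a)). Qed.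

Lemma twist_projP q : exists g, twist_proj g = q.
Proof.
by have [g gq] := ext_projP E (b q); exists g; rewrite /twist_proj gq autVK.
Qed.

Lemma twist_exact g : twist_proj g = 1 <-> exists h, twist_inj h = g.
Proof.
rewrite /twist_proj /twist_inj; split=> [g1|[h <-]]; last by rewrite proj_inj hom1.
have /ext_exact[h <-] : ext_proj E g = 1 by rewrite -[LHS](autKV b) g1 hom1.
by exists (a^-1 h); rewrite autKV.
Qed.

(** The middle group is unchanged; this is (a^-1)_* b^* E up to equivalence. *)
Definition twist : extension H Q :=
  @MkExt H Q E twist_inj twist_proj twist_injP twist_projP twist_exact.
End TwistedExtension.

Lemma twist_equiv E E' a b : ext_equiv E E' -> ext_equiv (twist E a b) (twist E' a b).
Proof.
case=> F [G FK GK] [Fi Fp]; apply: (@ext_equiv_intro _ _ (twist E a b) (twist E' a b) F G) => //.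
- by move=> x y; rewrite gmulfM.
- by move=> h; apply: Fi.
- by move=> g; rewrite /= /twist_proj Fp.
Qed.

(** The section u o b of the twisted extension has the factor set obtained by
    pulling back along b and pushing forward along a^-1. *)
Lemma presents_twist E f phi a b : presents E f phi ->
  presents (twist E a b) (fun q r => a^-1 (f (b q) (b r)))
    (fun q => a^-1 * phi (b q) * a^-1^-1).
Proof.
case=> u [u1 up uc um]; exists (fun q => u (b q) : twist E a b); split.
- by rewrite hom1.
- by move=> q; rewrite /= /twist_proj up autVK.
- move=> q h; rewrite [ext_inj _ h]/(ext_inj E (a h)) uc; congr (_ * _).
  by congr (ext_inj E _); rewrite !autM autKV invgK.
- by move=> q r; rewrite /= /twist_inj autKV um gmulfM.
Qed.

Lemma presents_pb E f phi b : presents E f phi ->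
  presents (pb_ext (aut_fun b) E) (fun q r => f (b q) (b r)) (fun q => phi (b q)).
Proof.
case=> u [u1 up uc um].
have pb q : (u (b q), q) \in @pb_pred H Q Q (aut_fun b) E by apply/eqP; rewrite /= up.
exists (fun q => MkPb (pb q)); split=> // [|q h|q r]; apply: val_inj.
- by congr (_, _); rewrite /= hom1.
- by congr (_, _); rewrite /= ?mul1g ?mulg1 // uc.
- by congr (_, _); rewrite /= ?mul1g // um gmulfM.
Qed.

(** A section of the pullback has components in E, and these form a section of
    the twisted extension. *)
Lemma presents_twist_pb E f phi a b : presents (pb_ext (aut_fun b) E) f phi ->
  presents (twist E a b) (fun q r => a^-1 (f q r)) (fun q => a^-1 * phi q * a^-1^-1).
Proof.
case=> u [u1 up uc um].
exists (fun q => (pb_val (u q)).1 : twist E a b); split.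
- by rewrite u1.
- move=> q; rewrite /= /twist_proj (eqP (pb_valP (u q))).
  by rewrite [(pb_val (u q)).2](up q) autVK.
- move=> q h; have /(congr1 (fun x => (pb_val x).1)) := uc q (a h).
  move=> e; apply: etrans e _; congr (_ * _).
  by congr (ext_inj E _); rewrite !autM autKV invgK.
- move=> q r; rewrite /= /twist_inj autKV.
  by have /(congr1 (fun x => (pb_val x).1)) := um q r.
Qed.

Variable Phi : Q -> Out H.
Implicit Types th : compat Phi.

(** Twisting a presentation of E and one of E' with the same [phi] turns their
    cocycle c into its transform under theta. *)
Lemma differs_by_twist E E' (x : H2 Phi) th : differs_by E E' x ->
  differs_by (twist E th.1 th.2) (twist E' th.1 th.2) (H2_act x th).
Proof.
case=> f [phi [c [hphi hE hE' <-]]].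
exists (fun q r => th.1^-1 (f (th.2 q) (th.2 r))),
  (fun q => th.1^-1 * phi (th.2 q) * th.1^-1^-1), (Z2_pull th c).
split; last by rewrite H2_actE.
- move=> q; rewrite !pi_outM hphi compatE invgK pi_outV !mulgA mulVg mul1g.
  by rewrite mulgVK.
- exact: presents_twist.
- have := presents_twist th.1 th.2 hE'; congr (presents _ _ _).
  by apply/funext => q; apply/funext => r; rewrite aut_funM.
Qed.

Lemma twist_assoc E th : associated_hom E Phi ->
  associated_hom (twist E th.1 th.2) Phi.
Proof.
move=> hE; have [x dx] := differs_by_ex hE hE.
by have [] := differs_by_assoc (differs_by_twist th dx).
Qed.

Lemma class_compatE E th : associated_hom E Phi ->
  class_compat (ext_class E) th = ext_class (twist E th.1 th.2).
Proof.
move=> hE; apply/funext => E'; apply/propext; split.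
  case=> f [phi [fs [[E1 eqE1 eqfs] eqE']]].
  apply: ext_equiv_trans (twist_equiv _ _ eqE1) _.
  apply: (presents_ext_equiv _ (presents_equiv eqE' (presents_fs _))).
  apply: presents_twist_pb.
  exact: presents_equiv (ext_equiv_sym eqfs) (presents_fs fs).
move=> eqE'; have /presentsP[f [phi [_ hf]]] := hE.
have pb := presents_pb th.2 hf.
have fs := presents_factor_set pb.
exists _, _, fs; split.
  exists E; first exact: (@ext_equiv_intro _ _ _ _ id id).
  exact: presents_ext_equiv pb (presents_fs fs).
apply: presents_ext_equiv (presents_fs _) _.
exact: presents_equiv eqE' (presents_twist _ _ hf).
Qed.

Lemma lambdaP E th (x : H2 Phi) : associated_hom E Phi ->
  lambda E th = x <-> differs_by (twist E th.1 th.2) E x.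
Proof.
move=> hE; rewrite /lambda class_compatE //; split=> [<-|]; last exact: class_diffP.
have [y dy] := differs_by_ex (@twist_assoc E th hE) hE.
by rewrite (class_diffP dy).
Qed.

Lemma differs_by_equivl E E1 E' (x : H2 Phi) :
  ext_equiv E E1 -> differs_by E E' x -> differs_by E1 E' x.
Proof.
move=> eqE [f [phi [c [hphi hE hE' cx]]]]; exists f, phi, c; split=> //.
exact: presents_equiv eqE hE.
Qed.

End Twist.

(** * The derivation and its zeros *)

Section Derivation.
Import GRing.Theory.
Variables (H Q : groupType) (E : extension H Q).
Variable Phi : {multiplicative Q -> Out H}.
Hypothesis hPhi : associated_hom E Phi.

Lemma twist_mul (th th' : compat Phi) :
  ext_equiv (twist (twist E th.1 th.2) th'.1 th'.2) (twist E (th * th').1 (th * th').2).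
Proof.
apply: (@ext_equiv_intro _ _ (twist (twist E th.1 th.2) th'.1 th'.2)
  (twist E (th * th').1 (th * th').2) id id) => //.
Qed.

Lemma lambda_derivation (th th' : compat Phi) :
  lambda E (th * th') = (H2_act (lambda E th) th' + lambda E th')%R.
Proof.
apply/lambdaP => //; apply: (differs_by_equivl (twist_mul th th')).
have /differs_by_twist d := (lambdaP th (lambda E th) hPhi).1 erefl.
exact: differs_by_add (d th') ((lambdaP th' _ hPhi).1 erefl).
Qed.

(** An equivalence F from the twisted extension to E satisfies
    F(i(alpha h)) = i(h) and pi(F x) = beta^-1(pi x); its inverse is the required
    automorphism. *)
Lemma lambda_eq0 (th : compat Phi) : lambda E th = 0%R <->
  exists2 g : Aut E, (forall h, g (ext_inj E h) = ext_inj E (th.1 h)) &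
    (forall x, ext_proj E (g x) = th.2 (ext_proj E x)).
Proof.
rewrite lambdaP // differs_by0; last exact: twist_assoc.
split=> [[F [G FK GK] [Fi Fp]]|[g gi gp]].
  have GM : {morph G : x y / x * y >-> (x * y : E)}.
    by move=> x y; apply: (can_inj FK); rewrite gmulfM !GK.
  exists (MkAut GM GK FK) => [h|x] /=.
    by rewrite -[RHS]FK; congr (G _); rewrite -(Fi h).
  by rewrite -{2}[x]GK Fp /= /twist_proj autKV.
apply: (@ext_equiv_intro _ _ (twist E th.1 th.2) E (aut_fun (g^-1)%g) g).
- by move=> x y; rewrite gmulfM.
- exact: autKV.
- exact: autVK.
- move=> h; apply: etrans (autVK g (ext_inj E h)).
  by congr (aut_fun (g^-1)%g _); rewrite gi.
- move=> x; apply: etrans (esym (autVK th.2 _)) _.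
  by congr (aut_fun (th.2^-1)%g _); rewrite -gp autKV.
Qed.
End Derivation.

(** * Cocycles and restriction of automorphisms *)

Section Automorphisms.
Import GRing.Theory.
Local Open Scope quotient_scope.
Variables (H Q : groupType) (E : extension H Q).
Variable Phi : {multiplicative Q -> Out H}.
Hypothesis hPhi : associated_hom E Phi.

(** Inside E, the action of q on the centre is conjugation by any g over q. *)
Lemma inj_qact (g : E) (z : cen H) :
  ext_inj E (cval (qact Phi (ext_proj E g) z)) * g = g * ext_inj E (cval z).
Proof.
have [a ha aPhi] := hPhi g.
by rewrite /qact aPhi cen_outE /= ha mulgVK.
Qed.

Section Mu.
Variable s : Z1 Phi.

Definition mu_fun (g : E) : E := ext_inj E (cval (s (ext_proj E g))) * g.
Definition mu_inv (g : E) : E := ext_inj E (cval (- s (ext_proj E g))%R) * g.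

Lemma cocycle1M q r : s (q * r) = (s q + qact Phi q (s r))%R.
Proof. by have /asboolP := z1valP s. Qed.

Lemma cocycle1_1 : s 1 = 0%R.
Proof.
have := cocycle1M 1 1; rewrite mulg1 -[LHS]addr0 => /addrI e.
have: ext_inj E (cval (s 1)) = 1.
  apply: (mulgI 1); rewrite -(inj_qact 1 (s 1)) hom1 -e cval0 hom1 mulg1.
  by [].
by rewrite -(hom1 (ext_inj E)) => /ext_injP h; apply: val_inj.
Qed.

Lemma mu_funM : {morph mu_fun : x y / x * y}.
Proof.
move=> x y; rewrite /mu_fun gmulfM cocycle1M cvalD gmulfM -!mulgA; congr (_ * _).
by rewrite !mulgA inj_qact.
Qed.

Lemma mu_funK : cancel mu_fun mu_inv.
Proof.
move=> g; rewrite /mu_inv /mu_fun gmulfM proj_inj mul1g mulgA -gmulfM -cvalD.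
by rewrite addNr hom1 mul1g.
Qed.

Lemma mu_invK : cancel mu_inv mu_fun.
Proof.
move=> g; rewrite /mu_inv /mu_fun gmulfM proj_inj mul1g mulgA -gmulfM -cvalD.
by rewrite addrN hom1 mul1g.
Qed.

Definition mu_aut : Aut E := MkAut mu_funM mu_funK mu_invK.

Lemma mu_restricts : mu_aut \in @restricts H Q E.
Proof.
apply/asboolP; exists 1 => h.
by rewrite /= /mu_fun proj_inj cocycle1_1 hom1 mul1g.
Qed.

Definition mu : AutRel E := MkAutRel mu_restricts.
End Mu.

Lemma ext_proj_eq (x y : E) : ext_proj E x = ext_proj E y ->
  exists h, y = ext_inj E h * x.
Proof.
move=> xy; have [|h hE] := (ext_exact (y * x^-1)).1.
  by rewrite gmulfM homV xy mulgV.
by exists h; rewrite hE mulgVK.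
Qed.

(** The automorphism induced on Q is defined through a section of the
    projection; the choice does not matter because g preserves H
    (see [proj_quot] in the proof).  Compatibility holds because conjugation by
    g(x) is the conjugate by g of conjugation by x. *)
Lemma res_exists (g : AutRel E) : exists th : compat Phi,
  (forall h, ext_inj E (th.1 h) = g (ext_inj E h)) /\
  (forall x, th.2 (ext_proj E x) = ext_proj E (g x)).
Proof.
have /asboolP[a ga] := autrel_valP g.
have gVa h : g^-1 (ext_inj E h) = ext_inj E (a^-1 h).
  by rewrite -{1}[h](autKV a) -ga autVK.
have [u up] := boolp.choice (@ext_projP H Q E).
have proj_quot (k : Aut E) (c : Aut H) :
    (forall h, k (ext_inj E h) = ext_inj E (c h)) ->
    forall x, ext_proj E (k (u (ext_proj E x))) = ext_proj E (k x).
  move=> kc x; have [|h ->] := @ext_proj_eq x (u (ext_proj E x)); first by rewrite up.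
  by rewrite aut_funM kc gmulfM proj_inj mul1g.
pose b q := ext_proj E (g (u q)); pose b' q := ext_proj E (g^-1 (u q)).
have bK : cancel b b' by move=> q; rewrite /b /b' (proj_quot _ _ gVa) autVK up.
have b'K : cancel b' b by move=> q; rewrite /b /b' (proj_quot _ _ ga) autKV up.
have bp x : b (ext_proj E x) = ext_proj E (g x) by apply: (proj_quot _ _ ga).
have bM : {morph b : q r / q * r}.
  move=> q r; rewrite -{1}[q]up -{1}[r]up -gmulfM bp aut_funM gmulfM.
  by [].
pose ab := (a, MkAut bM bK b'K).
have hab : ab \in compatible Phi.
  apply/asboolP => q; rewrite -[q]up /= bp.
  have [c hc ->] := hPhi (u q); have [d hd ->] := hPhi (g (u q)).
  rewrite -pi_outV -!pi_outM; congr (\pi_(Out H) _).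
  apply: autP => h; apply: (@ext_injP _ _ E).
  rewrite hd !autM -ga hc !gmulfM homV; congr (_ * _ * _).
  by apply: etrans (esym (ga _)); rewrite autKV.
by exists (MkCompat hab); split=> [h|x]; [rewrite ga|apply: bp].
Qed.

Lemma compat_eq (th th' : compat Phi) :
    (forall h, th.1 h = th'.1 h) -> (forall q, th.2 q = th'.2 q) -> th = th'.
Proof.
by move=> /autP h1 /autP h2; apply: val_inj; apply: injective_projections.
Qed.

Lemma autrel_eq (g k : AutRel E) : (forall x, g x = k x) -> g = k.
Proof. by move=> /autP gk; apply: val_inj. Qed.

(** Centrality of k(x) has to be established first: the proof that k depends
    only on the image of x in Q uses it. *)
Lemma trivial_restriction (g : AutRel E) :
    (forall h, g (ext_inj E h) = ext_inj E h) ->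
    (forall x, ext_proj E (g x) = ext_proj E x) ->
  exists s, mu s = g.
Proof.
move=> gi gp; have [u up] := boolp.choice (@ext_projP H Q E).
have /boolp.choice[k kE] x : exists h, g x = ext_inj E h * x.
  exact: ext_proj_eq (esym (gp x)).
have kcen x : k x \in @central H.
  apply: cenI => h; have [a ha _] := hPhi x.
  have hx : ext_inj E h * x = x * ext_inj E (a^-1 h).
    by rewrite -{1}[h](autKV a) ha mulgVK.
  apply: (@mul_inj_l H Q E _ _ x).
  rewrite !gmulfM -!mulgA -kE -[in RHS](gi h) -aut_funM hx aut_funM gi kE.
  by rewrite -!mulgA.
have kproj x y : ext_proj E x = ext_proj E y -> k x = k y.
  move=> /ext_proj_eq[h ->]; apply: (mulIg h).
  apply: (@mul_inj_l H Q E _ _ x).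
  rewrite !gmulfM -[in RHS]mulgA -kE aut_funM gi kE mulgA -!gmulfM.
  by have /= <- := cenP (MkCen (kcen x)) h.
pose s q := MkCen (kcen (u q)).
have scoc : s \in cocycle1 Phi.
  apply/asboolP => q r; apply: (@cval_inj H); rewrite cvalD.
  rewrite -[cval (s _)](kproj (u q * u r) (u (q * r))) ?gmulfM ?up //.
  apply: (@mul_inj_l H Q E _ _ (u q * u r)); rewrite -kE aut_funM.
  rewrite (kE (u q)) (kE (u r)) gmulfM -!mulgA; congr (_ * _).
  by have := inj_qact (u q) (s r); rewrite up !mulgA => ->.
exists (MkZ1 scoc); apply: autrel_eq => x.
by rewrite /= /mu_fun /= (kproj (u (ext_proj E x)) x) ?up // -kE.
Qed.

End Automorphisms.

Theorem theorem4p7 (H Q : groupType) (E : extension H Q)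
    (Phi : {multiplicative Q -> Out H}) (hPhi : associated_hom E Phi) :
  exists (mu : Z1 Phi -> AutRel E) (res : AutRel E -> compat Phi),
    (forall (s : Z1 Phi) (g : E),
       mu s g = ext_inj E (cval (s (ext_proj E g))) * g) /\
    (forall (g : AutRel E) (h : H),
       ext_inj E ((res g).1 h) = g (ext_inj E h)) /\
    (forall (g : AutRel E) (x : E),
       (res g).2 (ext_proj E x) = ext_proj E (g x)) /\
    (forall s t : Z1 Phi, mu (s + t)%R = mu s * mu t) /\
    (forall g k : AutRel E, res (g * k) = res g * res k) /\
    (forall th th' : compat Phi,
       lambda E (th * th') = (H2_act (lambda E th) th' + lambda E th')%R) /\
    injective mu /\
    (forall g : AutRel E, res g = 1 <-> exists s : Z1 Phi, mu s = g) /\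
    (forall th : compat Phi,
       lambda E th = 0%R <-> exists g : AutRel E, res g = th).
Proof.
have [res resP] := boolp.choice (res_exists hPhi).
have res1 g h : ext_inj E ((res g).1 h) = g (ext_inj E h) by case: (resP g).
have res2 g x : (res g).2 (ext_proj E x) = ext_proj E (g x) by case: (resP g).
have res_eq (g : AutRel E) (th : compat Phi) : (forall h, ext_inj E (th.1 h) = g (ext_inj E h)) ->
    (forall x, th.2 (ext_proj E x) = ext_proj E (g x)) -> res g = th.
  move=> h1 h2; apply: compat_eq => [h|q].
    by apply: (@ext_injP _ _ E); rewrite res1 h1.
  by have [x <-] := ext_projP E q; rewrite res2 h2.
exists (mu hPhi), res; split=> //; split=> //; split=> //.
split; last split; last split; last split; last split.
- move=> s t; apply: autrel_eq => x.
  rewrite /= /mu_fun gmulfM proj_inj mul1g mulgA -gmulfM.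
  by rewrite -cvalD.
- move=> g k; apply: res_eq => [h|x].
    by rewrite [LHS]res1 res1.
  exact: etrans (congr1 (res g).2 (res2 k x)) (res2 g (k x)).
- exact: lambda_derivation.
- move=> s t st; apply: val_inj; apply/funext => q.
  have [x <-] := ext_projP E q; apply: (@cval_inj H).
  apply: (@mul_inj_l H Q E _ _ x).
  exact: (congr1 (fun g : AutRel E => g x) st).
- move=> g; split=> [g1|[s <-]].
    apply: trivial_restriction => [h|x]; first by rewrite -res1 g1.
    by rewrite -res2 g1.
  apply: res_eq => [h|x] /=; rewrite /mu_fun.
    by rewrite proj_inj (cocycle1_1 hPhi) cval0 hom1 mul1g.
  by rewrite gmulfM proj_inj mul1g.
move=> th; rewrite lambda_eq0 //; split=> [[g gi gp]|[g <-]].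
  have gr : g \in @restricts H Q E by apply/asboolP; exists th.1.
  by exists (MkAutRel gr); apply: res_eq => [h|x]; rewrite ?gi ?gp.
by exists (autrel_val g) => [h|x]; rewrite ?res1 ?res2.
Qed.
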